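(* Let $\mathfrak E$ be an EOS satisfying the standing assumptions below. If $\iota$ and $\tau$ are configurations of $\mathfrak E$ and $\tau$ is $\le_f$-coverable from $\iota$ in $\mathfrak E^{cons}$, then $\tau$ is $(\le_f,\omega)$-coverable from $\iota$ in $\mathfrak E$.
   Context: EOS: A PN is $(P,T,F)$ with $F:(P\times T)\cup(T\times P)\to\mathbb N$, ${\tt pre}_N(t)(p)=F(p,t)$, ${\tt post}_N(t)(p)=F(t,p)$; $\blacksquare=(\emptyset,\emptyset,\emptyset)$ with unique marking $\varepsilon$. An EOS is $(\hat N,\mathcal N,d,\Theta)$: system PN $\hat N=(\hat P,\hat T,\hat F)$ containing idle transitions $id_p$ ($p\in\hat P$) consuming and producing one token on $p$ only; finite set $\mathcal N\ni\blacksquare$ of object PNs, all nets pairwise disjoint; typing $d:\hat P\to\mathcal N$; finite event set $\Theta$ of pairs $(\hat\tau,\theta)$, $\hat\tau\in\hat T$, $\theta(N)$ a finite multiset of transitions of $N$, with $\theta(d(p))\ne\emptyset$ if $\hat\tau=id_p$. Configurations: finite multisets of nested tokens $(\hat p,m)$, $m$ a marking of $d(\hat p)$. With $\Pi^1(\sum_i(\hat p_i,m_i))=\sum_i\hat p_i$, $\Pi^2_N(\sum_i(\hat p_i,m_i))=\sum_{d(\hat p_i)=N}m_i$: event $(\hat\tau,\theta)$ fires on $\mu$ with mode $(\lambda,\rho)$ iff $\lambda\sqsubseteq\mu$, $\Pi^1(\lambda)={\tt pre}_{\hat N}(\hat\tau)$, $\Pi^1(\rho)={\tt post}_{\hat N}(\hat\tau)$,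 and for all $N$: $\Pi^2_N(\lambda)\ge{\tt pre}_N(\theta(N))$, $\Pi^2_N(\rho)=\Pi^2_N(\lambda)-{\tt pre}_N(\theta(N))+{\tt post}_N(\theta(N))$; result $\mu-\lambda+\rho$. $\mu\le_f\mu'$ iff $\mu'$ arises from $\mu$ by adding tokens inside existing nested tokens and/or adding nested tokens. An event is system autonomous if $\theta(N)=\emptyset$ for all $N$. $\tau$ is $\le_f$-coverable from $\iota$ if some configuration reachable from $\iota$ by event firings is $\ge_f\tau$. A $(\le_f,\omega)$-run is a finite sequence of configurations in which each consecutive pair is a firing step $C_i\to^eC_{i+1}$ or a lossy step $C_{i+1}\le_f C_i$; $\tau$ is $(\le_f,\omega)$-coverable from $\iota$ if such a run leads from $\iota$ to some configuration $\ge_f\tau$. $t\in\hat T$ destroys type $N$ if $\hat F(p,t)\ne0$ for some $p$ with $d(p)=N$ and $\hat F(t,q)=0$ for all $q$ with $d(q)=N$; $\mathit{destroy}(t)$ is the set of such $N$. Standing assumptions on $\mathfrak E$: every $t\in\hat T$ occurs in exactly one event of $\Theta$, and if $\mathit{destroy}(t)\ne\emptyset$ that event is system autonomous. Conservative closure: $\mathfrak E^{cons}=(\hat N^{cons},\mathcal N,d^{cons},\Theta)$, $\hat N^{cons}=(\hat P\cup\{\mathit{trash}_N:N\in\mathcal N\},\hat T,\hat F^{cons})$ with new places $\mathit{trash}_N$, $\hat F^{cons}(p,t)=\hat F(p,t)$ (zero on trash places), $\hat F^{cons}(t,p)=\hat F(t,p)$ for $p\in\hat P$, $\hat F^{cons}(t,\mathit{trash}_N)=1$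 iff $N\in\mathit{destroy}(t)$ (else $0$), $d^{cons}$ extends $d$ by $d^{cons}(\mathit{trash}_N)=N$. Configurations of $\mathfrak E$ are configurations of $\mathfrak E^{cons}$. *)

(* Defs.v *)
From HB Require Import structures.
From mathcomp Require Import all_boot finmap multiset.
From mathcomp Require Import boolp.

Set Implicit Arguments.
Unset Strict Implicit.
Unset Printing Implicit Defensive.

Local Open Scope mset_scope.

(* Finiteness of the place and transition sets is not required; finite nets
   are the instances where both types are finTypes. *)
Record petri := Petri {
  place : choiceType;
  trans : choiceType;
  flow : (place * trans) + (trans * place) -> nat
}.

Definition pre (N : petri) (t : trans N) (p : place N) : nat :=
  flow (inl (p, t)).
Definition post (N : petri) (t : trans N) (p : place N) : nat :=
  flow (inr (t, p)).

Definition preM (N : petri) (th : {mset trans N}) (p : place N) : nat :=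
  \sum_(t <- th) pre t p.
Definition postM (N : petri) (th : {mset trans N}) (p : place N) : nat :=
  \sum_(t <- th) post t p.

Notation marking N := {mset place N}.

(* The sets of places and transitions are separate types, so N is the empty
   net iff both are uninhabited. *)
Definition empty_net (N : petri) : Prop :=
  (place N -> False) /\ (trans N -> False).

Definition event_type (sys : petri) (obj : finType) (net : obj -> petri)
    : choiceType :=
  (trans sys * {dffun forall N : obj, {mset trans (net N)}})%type.

(* The tuple (system net, object nets, typing, events) without the requirement
   on idle transitions: the conservative closure keeps the transitions of the
   original system net, hence has no idle transition on the trash places.
   The finite set of object nets is the family [net] indexed by [obj]; nets are
   disjoint because each has its own types of places and transitions.  Since the
   object nets form a set, the empty net has exactly one index, [bsq]. *)
Record eos_data := EOSData {
  sys : petri;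
  obj : finType;
  net : obj -> petri;
  bsq : obj;
  bsqP : forall N : obj, empty_net (net N) <-> N = bsq;
  typ : place sys -> obj;
  events : {fset event_type sys net}
}.

Definition event (E : eos_data) : choiceType := event_type (sys E) (@net E).

Record eos := EOS {
  eos_of :> eos_data;
  idle : place (sys eos_of) -> trans (sys eos_of);
  idleP : forall p q, pre (idle p) q = (q == p) /\ post (idle p) q = (q == p);
  idle_event : forall (e : event eos_of) (p : place (sys eos_of)),
    e \in events eos_of -> e.1 = idle p -> e.2 (typ p) <> mset0
}.

Section Semantics.
Variable E : eos_data.

Definition ntoken : choiceType :=
  {p : place (sys E) & marking (net (typ p))}.

Definition config := {mset ntoken}.
Identity Coercion mset_of_config : config >-> multiset_of.

Definition Pi1 (mu : config) (p : place (sys E)) : nat :=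
  \sum_(x <- mu) (tag x == p).

Definition inner (x : ntoken) : {N : obj E & marking (net N)} :=
  Tagged (fun N : obj E => marking (net N)) (tagged x).

(* [untag 0 F (inner x)] is [F m] if [x = (p, m)] with [typ p = N], else 0. *)
Definition Pi2 (N : obj E) (mu : config) (q : place (net N)) : nat :=
  \sum_(x <- mu) untag 0 (fun m : marking (net N) => m q) (inner x).

Definition enabled_mode (e : event E) (mu lam rho : config) : Prop :=
  [/\ lam `<=` mu,
      (forall p, Pi1 lam p = pre e.1 p),
      (forall p, Pi1 rho p = post e.1 p),
      (forall (N : obj E) (q : place (net N)),
          preM (e.2 N) q <= Pi2 lam q) &
      (forall (N : obj E) (q : place (net N)),
          Pi2 rho q = Pi2 lam q - preM (e.2 N) q + postM (e.2 N) q)].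

Definition fires (e : event E) (mu mu' : config) : Prop :=
  exists lam rho : config,
    enabled_mode e mu lam rho /\ mu' = (mu `\` lam) `+` rho.

Definition step (mu mu' : config) : Prop :=
  exists2 e : event E, e \in events E & fires e mu mu'.

Definition token_le (x y : ntoken) : bool :=
  (tag x == tag y) && (tagged x `<=` tagged_as x y).

(* [s] pairs each nested token of [mu] with its enlarged copy in [mu']; the
   nested tokens of [mu'] not covered by [s] are the added ones. *)
Definition le_f (mu mu' : config) : Prop :=
  exists s : seq (ntoken * ntoken),
    [/\ all (fun xy => token_le xy.1 xy.2) s,
        seq_mset (unzip1 s) = mu &
        seq_mset (unzip2 s) `<=` mu'].

Fixpoint is_run (R : config -> config -> Prop) (C : config) (s : seq config)
    : Prop :=
  if s is C' :: s' then R C C' /\ is_run R C' s' else True.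

Definition coverable (iota tau : config) : Prop :=
  exists s : seq config, is_run step iota s /\ le_f tau (last iota s).

Definition step_or_lose (C C' : config) : Prop := step C C' \/ le_f C' C.

Definition lossy_coverable (iota tau : config) : Prop :=
  exists s : seq config, is_run step_or_lose iota s /\ le_f tau (last iota s).

Definition destroys (t : trans (sys E)) (N : obj E) : Prop :=
  (exists2 p : place (sys E), typ p = N & pre t p <> 0) /\
  (forall q : place (sys E), typ q = N -> post t q = 0).

Definition system_autonomous (e : event E) : Prop :=
  forall N : obj E, e.2 N = mset0.

Definition standing_assumptions : Prop :=
  (forall t : trans (sys E),
      exists! e : event E, e \in events E /\ e.1 = t) /\
  (forall e : event E, e \in events E ->
      (exists N : obj E, destroys e.1 N) -> system_autonomous e).

(* The place [inr N] is trash_N. *)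
Definition cons_sys : petri :=
  @Petri (place (sys E) + obj E)%type (trans (sys E))
    (fun a => match a with
              | inl (inl p, t) => pre t p
              | inl (inr _, _) => 0
              | inr (t, inl p) => post t p
              | inr (t, inr N) => `[< destroys t N >]
              end).

Definition cons_typ (p : place cons_sys) : obj E :=
  match p with inl p => typ p | inr N => N end.

Definition cons_closure : eos_data :=
  @EOSData cons_sys (obj E) (@net E) (bsq E) (@bsqP E) cons_typ (events E).

End Semantics.

Definition cons_token (E : eos_data) (x : ntoken E) : ntoken (cons_closure E) :=
  Tagged (fun p : place (sys (cons_closure E)) => marking (net (typ p)))
         (tagged x : marking (@net (cons_closure E) (@typ (cons_closure E) (inl (tag x))))).

Definition cons_config (E : eos_data) (mu : config E) : config (cons_closure E) :=
  seq_mset [seq cons_token x | x <- mu].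

(* Main.v *)
Require Import Defs.
From mathcomp Require Import all_boot finmap multiset.
From mathcomp Require Import boolp.

(** Project a configuration of the conservative closure to one of [E] by
    deleting the trash tokens.  A firing of the closure never consumes trash,
    and it produces trash only if its transition destroys some type; then the
    event is system autonomous, so the content of the consumed tokens of a
    destroyed type is exactly what ends up in trash.  In [E] the same transition
    fires after a lossy step that empties these consumed tokens, and it reaches
    the projection of the original successor. *)

Set Implicit Arguments.
Unset Strict Implicit.
Unset Printing Implicit Defensive.

Local Open Scope mset_scope.

Section Tokens.
Variable E : eos_data.
Implicit Types (mu : config E) (N : obj E).

Lemma Pi1_eq0 mu p x : Pi1 mu p = 0 -> x \in mu -> tag x != p.
Proof.
move/eqP; rewrite /Pi1 sum_nat_seq_eq0 => /allP mu0 /mu0 /=.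
by rewrite eqb0.
Qed.

Lemma Pi2_eq0 mu N (q : place (net N)) :
  (forall x, x \in mu -> typ (tag x) != N) -> Pi2 mu q = 0.
Proof.
by move=> muN; rewrite /Pi2 big_seq big1 // => x /muN neN; rewrite untag_dflt.
Qed.

(** With both tokens on the place [p], the transport hidden in [tagged_as] is trivial. *)
Lemma token_leE p (m m' : marking (net (@typ E p))) :
  token_le (existT _ p m) (existT _ p m') = (m `<=` m').
Proof.
rewrite /token_le eqxx /=; congr (_ `<=` _).
exact: (tagged_asE (u := existT _ p m) m').
Qed.

Lemma token_le_refl : reflexive (@token_le E).
Proof. by case=> p m; rewrite token_leE msubset_refl. Qed.

End Tokens.

Section EmptyTokens.
Variables (E : eos_data) (D : pred (obj E)).
Implicit Types (x : ntoken E) (mu lam : config E) (N : obj E).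

(** [D] will be the set of types destroyed by the fired transition. The token keeps its place, so
    the system net sees the same preset. *)
Definition empty_token x : ntoken E :=
  if D (typ (tag x)) then
    Tagged (fun p : place (sys E) => marking (net (typ p)))
           (mset0 : marking (net (typ (tag x))))
  else x.

Definition empty_tokens mu : config E :=
  seq_mset [seq empty_token x | x <- mu].

Lemma tag_empty_token x : tag (empty_token x) = tag x.
Proof. by rewrite /empty_token; case: ifP. Qed.

Lemma empty_token_le x : token_le (empty_token x) x.
Proof.
case: x => p m; rewrite /empty_token /=.
case: ifP => _; last exact: token_le_refl.
by rewrite token_leE; apply/msubsetP=> z; rewrite mset0E.
Qed.

Lemma Pi1_empty_tokens mu p : Pi1 (empty_tokens mu) p = Pi1 mu p.
Proof.
rewrite /Pi1 (perm_big _ (perm_eq_seq_mset _)) /= big_map.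
by apply: eq_bigr => x _; rewrite tag_empty_token.
Qed.

Lemma untag_empty_token N (q : place (net N)) x :
  untag 0 (fun m : marking (net N) => m q) (inner (empty_token x)) =
  if D N then 0 else untag 0 (fun m : marking (net N) => m q) (inner x).
Proof.
have [eN|neN] := eqVneq (typ (tag x)) N; last first.
  by rewrite !untag_dflt ?if_same //= tag_empty_token.
case: _ / eN q => q; rewrite /empty_token; case: ifP => // _.
rewrite (untagE (u := inner (Tagged _ _)) _ _ (erefl (typ (tag x)))) /=.
exact: mset0E.
Qed.

Lemma Pi2_empty_tokens mu N (q : place (net N)) :
  Pi2 (empty_tokens mu) q = if D N then 0 else Pi2 mu q.
Proof.
rewrite /Pi2 (perm_big _ (perm_eq_seq_mset _)) /= big_map.
under eq_bigr do rewrite untag_empty_token.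
by case: ifP => // _; rewrite big1.
Qed.

Lemma empty_tokens_le lam mu :
  lam `<=` mu -> le_f ((mu `\` lam) `+` empty_tokens lam) mu.
Proof.
move=> /msubsetP lam_mu.
(* Tokens outside [lam] are paired with themselves, those of [lam] with their emptied versions. The
   second components add up to [mu] because [lam] is contained in it. *)
exists ([seq (x, x) | x <- mu `\` lam] ++ [seq (empty_token x, x) | x <- lam]).
split.
- rewrite all_cat !all_map; apply/andP; split; apply/allP=> x _ /=.
    exact: token_le_refl.
  exact: empty_token_le.
- apply/msetP=> x; rewrite mset_seqE /unzip1 map_cat -!map_comp count_cat.
  by rewrite map_id count_mem_mset !msetE2 [empty_tokens lam x]mset_seqE.
- apply/msubsetP=> x; rewrite mset_seqE /unzip2 map_cat -!map_comp count_cat.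
  by rewrite !map_id !count_mem_mset msetE2 subnK.
Qed.

End EmptyTokens.

Section DropTrash.
Variable E : eos_data.
Let C := cons_closure E.
Implicit Types (mu lam rho : config C) (N : obj E).

Definition uncons_token (x : ntoken C) : option (ntoken E) :=
  match x with
  | existT (inl p) m =>
      Some (Tagged (fun p : place (sys E) => marking (net (typ p))) m)
  | existT (inr _) _ => None
  end.

Definition drop_trash mu : config E := seq_mset (pmap uncons_token mu).

Lemma cons_tokenK : pcancel (@cons_token E) uncons_token.
Proof. by case. Qed.

Lemma uncons_tokenK : ocancel uncons_token (@cons_token E).
Proof. by case=> [[p|N] m]. Qed.

Lemma cons_configK (mu0 : config E) : drop_trash (cons_config mu0) = mu0.
Proof.
rewrite -[RHS]seq_mset_id; apply/eq_seq_msetP.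
rewrite -[X in perm_eq _ X](map_pK cons_tokenK).
exact: (perm_pmap _ (perm_eq_seq_mset _)).
Qed.

(** [cons_token] is a bijection onto the non-trash tokens, so multiplicities are preserved. This
    reduces the compatibility of [drop_trash] with multiset operations to pointwise identities. *)
Lemma drop_trashE mu x : drop_trash mu x = mu (cons_token x).
Proof.
rewrite mset_seqE -count_mem_mset; elim: {mu}(mu : seq _) => //= y s <-.
have -> : (y == cons_token x) = (uncons_token y == Some x).
  apply/eqP/eqP=> [->|yx]; first exact: cons_tokenK.
  by have := uncons_tokenK y; rewrite yx.
by case: (uncons_token y).
Qed.

Lemma mem_drop_trash mu x : (x \in drop_trash mu) = (cons_token x \in mu).
Proof. by rewrite !in_mset drop_trashE. Qed.

Lemma drop_trash_sub lam mu : lam `<=` mu -> drop_trash lam `<=` drop_trash mu.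
Proof. by move/msubsetP=> le; apply/msubsetP=> x; rewrite !drop_trashE. Qed.

Lemma drop_trash_replace mu lam rho :
  drop_trash ((mu `\` lam) `+` rho) =
  (drop_trash mu `\` drop_trash lam) `+` drop_trash rho.
Proof. by apply/msetP=> x; rewrite !(msetE2, drop_trashE). Qed.

Lemma sum_drop_trash mu (F : ntoken C -> nat) :
  \sum_(x <- mu) F x =
  \sum_(x <- drop_trash mu) F (cons_token x) +
  \sum_(x <- mu | ~~ uncons_token x) F x.
Proof.
rewrite (perm_big _ (perm_eq_seq_mset _)) /=.
elim: {mu}(mu : seq _) => [|x s IHs]; first by rewrite !big_nil.
rewrite !big_cons IHs /=; case: x => [[p|N] m] /=; last by rewrite addnCA.
by rewrite big_cons addnA.
Qed.

Lemma Pi1_drop_trash mu p : Pi1 (drop_trash mu) p = Pi1 mu (inl p).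
Proof.
by rewrite [RHS]sum_drop_trash [X in _ + X]big1 ?addn0 // => -[[q|N] m].
Qed.

(** Only tokens on the trash place of [N] could be lost from this projection: trash of any other
    type contributes [0]. *)
Lemma Pi2_drop_trash mu N (q : place (net N)) :
  Pi1 mu (inr N) = 0 -> Pi2 (drop_trash mu) q = Pi2 (E := C) mu q.
Proof.
move=> muN; rewrite [RHS]sum_drop_trash [X in _ + X]big_seq_cond.
rewrite [X in _ + X]big1 ?addn0 // => -[[p|N'] m].
  by rewrite andbF.
case/andP=> /(Pi1_eq0 muN) /= neN _.
by apply: untag_dflt; apply: contraNneq neN => /= ->.
Qed.

(** Comparable tokens share their place, so either both are trash or neither is. *)
Lemma uncons_token_le (x y : ntoken C) : token_le x y ->
  match uncons_token x, uncons_token y with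
  | Some x0, Some y0 => token_le x0 y0
  | None, None => true
  | _, _ => false
  end.
Proof.
move=> xy; have /andP[/eqP exy _] := xy.
case: x y exy xy => [p m] [p' m'] /= e; case: _ / e m' => m'.
by rewrite token_leE; case: p m m' => [p|N] m m' //=; rewrite token_leE.
Qed.

Lemma drop_trash_le mu mu' :
  le_f mu mu' -> le_f (drop_trash mu) (drop_trash mu').
Proof.
case=> s [s_le <- s_sub].
(* [h] removes the trash pairs from the witness [s]. Mixed pairs cannot occur, so this filtering
   commutes with both component projections. *)
pose h xy := if (uncons_token xy.1, uncons_token xy.2) is (Some x, Some y)
             then Some (x, y) else None.
have [h_le h1 h2] : [/\ all (fun xy => token_le xy.1 xy.2) (pmap h s),
    unzip1 (pmap h s) = pmap uncons_token (unzip1 s) &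
    unzip2 (pmap h s) = pmap uncons_token (unzip2 s)].
  elim: s s_le {s_sub} => //= -[x y] s IHs /andP[/uncons_token_le xy /IHs[]].
  rewrite /h /=; move: xy.
  case: (uncons_token x) (uncons_token y) => [x0|] [y0|] //=.
  by move=> -> -> -> ->.
exists (pmap h s); split=> //.
  rewrite h1; apply/eq_seq_msetP; rewrite perm_sym.
  exact: (perm_pmap _ (perm_eq_seq_mset _)).
apply: msubset_trans (drop_trash_sub s_sub).
rewrite h2; apply/msubsetP=> x; rewrite !mset_seqE.
have /(perm_pmap uncons_token)/permP -> // := perm_eq_seq_mset (unzip2 s).
Qed.

End DropTrash.

Section Simulation.
Variable E : eos_data.
Hypothesis autonomous : forall e : event E, e \in events E ->
  (exists N : obj E, destroys e.1 N) -> system_autonomous e.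

Lemma lossy_simulation (mu mu' : config (cons_closure E)) : step mu mu' ->
  exists2 nu, le_f nu (drop_trash mu) & step nu (drop_trash mu').
Proof.
case=> e e_ev [lam [rho [[lam_mu lam1 rho1 lam2 rho2] ->]]].
pose D (N : obj E) := `[< @destroys E e.1 N >].
have lam_trash N : Pi1 lam (inr N) = 0 by rewrite lam1.
(* [lam0] is what fires in [E]: the consumed tokens, emptied when their type is destroyed. *)
pose lam0 := empty_tokens D (drop_trash lam).
exists ((drop_trash mu `\` drop_trash lam) `+` lam0).
  exact/empty_tokens_le/drop_trash_sub.
(* Autonomy makes the emptying harmless: the event needs no tokens inside nets of destroyed
   types. *)
have autD N : D N -> e.2 N = mset0.
  by move=> /asboolP DN; apply: autonomous => //; exists N.
have preM0 (N : obj E) (q : place (net N)) : preM mset0 q = 0.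
  by rewrite /preM enum_mset0 big_nil.
have postM0 (N : obj E) (q : place (net N)) : postM mset0 q = 0.
  by rewrite /postM enum_mset0 big_nil.
exists e => //; exists lam0, (drop_trash rho); split; last first.
  by rewrite drop_trash_replace; congr (_ `+` _); rewrite msetDKBC.
split.
- by apply/msubsetP=> x; rewrite msetE2 leq_addl.
- by move=> p; rewrite Pi1_empty_tokens Pi1_drop_trash lam1.
- by move=> p; rewrite Pi1_drop_trash rho1.
- move=> N q; rewrite Pi2_empty_tokens; case: ifP => [/autD ->|_].
    by rewrite preM0.
  by rewrite Pi2_drop_trash //; apply: lam2.
(* If [N] is destroyed, both sides are [0]: the content of type [N] in [rho] lies entirely on the
   trash place. *)
- move=> N q; rewrite Pi2_empty_tokens; case: ifP => [DN|DN].
    rewrite autD // preM0 postM0; apply: Pi2_eq0 => x.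
    rewrite mem_drop_trash => x_rho.
    apply/eqP=> xN; have /asboolP[_ /(_ _ xN) post0] := DN.
    have rho0 : Pi1 rho (inl (tag x)) = 0 by rewrite rho1.
    by have /eqP := Pi1_eq0 rho0 x_rho.
  (* Otherwise the equation is [rho2], once it is known that [rho] puts nothing on the trash place
     of [N]. *)
  rewrite !Pi2_drop_trash //.
  by rewrite rho1 /post /= -/(D N) DN.
Qed.

Lemma lossy_simulation_run (mu : config (cons_closure E)) s :
  is_run (@step _) mu s ->
  exists2 s', is_run (@step_or_lose E) (drop_trash mu) s' &
    last (drop_trash mu) s' = drop_trash (last mu s).
Proof.
elim: s mu => [|mu' s IHs] mu /=; first by exists [::].
case=> /lossy_simulation[nu lose fire] /IHs[s' run' last'].
by exists [:: nu, drop_trash mu' & s'] => //=; split; [right | split; [left |]].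
Qed.

End Simulation.

Theorem theorem5 (E : eos) (iota tau : config E) :
  standing_assumptions E ->
  coverable (cons_config iota) (cons_config tau) ->
  lossy_coverable iota tau.
Proof.
move=> [_ autonomous] [s [/(lossy_simulation_run autonomous) [s']]].
rewrite cons_configK => run' last' cover; exists s'; split=> //.
(* Neither [iota] nor [tau] contains trash, so dropping it recovers both, and its monotonicity
   transfers the final covering. *)
by rewrite last' -[tau]cons_configK; apply: drop_trash_le.
Qed.
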